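(* Let $\mu\ge0$, $s>0$, and let $f:\mathbb{R}^n\to\mathbb{R}$ be continuously differentiable, $\mu$-strongly convex (possibly $\mu=0$) and $(1/s)$-smooth, with a minimizer $x^*$. Let $(\mathbf{t}_k)_{k=0}^\infty$ be a strictly increasing sequence in $[0,\infty)$ satisfying $$\frac{2\sqrt s}{\mathbf{t}_k}\operatorname{cothc}\left(\frac{\sqrt\mu}{2}\mathbf{t}_k\right)\le1\quad\text{for all }k\ge2$$ and $$\left(1-\frac{2\sqrt s}{\mathbf{t}_{k+1}}\operatorname{cothc}\left(\frac{\sqrt\mu}{2}\mathbf{t}_{k+1}\right)\right)\frac{\mathbf{t}_{k+1}^2}{4}\operatorname{sinhc}^2\left(\frac{\sqrt\mu}{2}\mathbf{t}_{k+1}\right)\le\frac{\mathbf{t}_k^2}{4}\operatorname{sinhc}^2\left(\frac{\sqrt\mu}{2}\mathbf{t}_k\right)\quad\text{for all }k\ge0.$$ Let the iterates of the unified NAG family be generated from $x_0=z_0\in\mathbb{R}^n$ by, for $k\ge0$, $$y_k=x_k+\frac{\frac{2\sqrt s}{\mathbf{t}_{k+1}}\operatorname{cothc}\left(\frac{\sqrt\mu}{2}\mathbf{t}_{k+1}\right)-\mu s}{1-\mu s}(z_k-x_k),\qquad x_{k+1}=y_k-s\nabla f(y_k),$$ $$z_{k+1}=z_k+\frac{\sqrt s\,\mathbf{t}_{k+1}}{2}\operatorname{tanhc}\left(\frac{\sqrt\mu}{2}\mathbf{t}_{k+1}\right)\left(\mu y_k-\mu z_k-\nabla f(y_k)\right).$$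 Then for all $k\ge0$ (with $\mathbf{t}_k>0$), $$f(x_k)-f(x^* )\le\frac{4}{\mathbf{t}_k^2}\operatorname{cschc}^2\left(\frac{\sqrt\mu}{2}\mathbf{t}_k\right)\left(\frac12\cosh^2\left(\frac{\sqrt\mu}{2}\mathbf{t}_0\right)\|x_0-x^*\|^2+\frac{\mathbf{t}_0^2}{4}\operatorname{sinhc}^2\left(\frac{\sqrt\mu}{2}\mathbf{t}_0\right)\left(f(x_0)-f(x^* )\right)\right).$$
   Context: $\operatorname{sinhc}(x)=\sinh(x)/x$ for $x\ne0$, $\operatorname{sinhc}(0)=1$; $\operatorname{tanhc}(x)=\operatorname{sinhc}(x)/\cosh(x)$; $\operatorname{cothc}(x)=1/\operatorname{tanhc}(x)$; $\operatorname{cschc}(x)=1/\operatorname{sinhc}(x)$. $f$ is $\mu$-strongly convex if $f(y)\ge f(x)+\langle\nabla f(x),y-x\rangle+\frac{\mu}{2}\|y-x\|^2$ for all $x,y$; $f$ is $L$-smooth if $\nabla f$ is $L$-Lipschitz. *)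

(* Defs.v *)
From HB Require Import structures.
From mathcomp Require Import all_boot all_order all_algebra.
From mathcomp Require Import all_classical all_reals all_analysis.

Set Implicit Arguments.
Unset Strict Implicit.
Unset Printing Implicit Defensive.

Import Order.TTheory GRing.Theory Num.Theory.
Import numFieldNormedType.Exports.

Local Open Scope classical_set_scope.
Local Open Scope ring_scope.

Section HyperbolicFunctions.
Context {R : realType}.
Implicit Types x : R.

Definition sinh x : R := (expR x - expR (- x)) / 2.
Definition cosh x : R := (expR x + expR (- x)) / 2.

Definition sinhc x : R := if x == 0 then 1 else sinh x / x.
Definition tanhc x : R := sinhc x / cosh x.
Definition cothc x : R := 1 / tanhc x.
Definition cschc x : R := 1 / sinhc x.

End HyperbolicFunctions.

Section EuclideanSpace.
Context {R : realType} {n : nat}.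
Implicit Types (x y : 'rV[R]_n) (f : 'rV[R]_n -> R).

Definition dot x y : R := \sum_(i < n) x 0 i * y 0 i.

(* The library norm `|x| on 'rV[R]_n is the sup norm, hence a separate
   Euclidean norm. *)
Definition enorm x : R := Num.sqrt (dot x x).

(* The vector of partial derivatives; it represents the differential of f at x
   for the inner product dot when f is differentiable at x. *)
Definition grad f x : 'rV[R]_n := \row_(i < n) 'D_(delta_mx 0 i) f x.

(* The topology on 'rV[R]_n does not depend on the choice of norm. *)
Definition continuously_differentiable f : Prop :=
  (forall x, differentiable f x) /\ continuous (grad f).

Definition strongly_convex (mu : R) f : Prop :=
  forall x y, f x + dot (grad f x) (y - x) + mu / 2 * enorm (y - x) ^+ 2 <= f y.

Definition smooth (L : R) f : Prop :=
  forall x y, enorm (grad f x - grad f y) <= L * enorm (x - y).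

Definition minimizer f x : Prop := forall y, f x <= f y.

End EuclideanSpace.

(* Main.v *)
Require Import Defs.
From HB Require Import structures.
From mathcomp Require Import all_boot all_order all_algebra.
From mathcomp Require Import all_classical all_reals all_analysis.
From mathcomp Require Import ring lra.

Import Order.TTheory GRing.Theory Num.Theory.
Import numFieldNormedType.Exports.

Local Open Scope ring_scope.

(** The proof is a discrete Lyapunov argument.  Write
    S_k = (t_k / 2) sinhc (sqrt mu t_k / 2), C_k = cosh (sqrt mu t_k / 2) and
    A_k = S_k ^ 2, so that C_k ^ 2 = 1 + mu A_k.  The energy
      E_k = A_k (f x_k - f x* ) + (1 + mu A_k) / 2 |z_k - x*|^2
    does not increase with k, and E_0 is the second factor of the bound because
    z_0 = x_0.  Since the quadratic part is nonnegative,
    A_k (f x_k - f x* ) <= E_k <= E_0, and 1 / A_k is the first factor.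

    The parameters of the scheme become alpha = sqrt s C / S, the coupling
    coefficient in y_k, and delta = sqrt s S / C, the step size of z_k, all
    taken at index k + 1.  What the energy argument needs of them is
    alpha delta = s and alpha A = delta (1 + mu A): then, in the expansion of
    |z_{k+1} - x*|^2, the term in |grad f (y_k)|^2 is exactly the decrease of f
    along the gradient step, and the terms linear in the gradient cancel against
    the strong convexity inequalities from y_k to x_k (weight 1 - alpha) and
    from y_k to x* (weight alpha).  This yields [energy_step], which bounds
    E_{k+1} by the energy with coefficient (1 - alpha) A_{k+1}; the step
    condition on t and [energy_le] replace this coefficient by A_k.

    Two points need care.  The identity alpha ^ 2 = mu s + s / A shows that
    alpha <= 1, assumed from index 2 on, forces mu s < 1, so the division by
    1 - mu s is legitimate; it also gives mu s <= alpha.  At the first step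
    alpha may exceed 1, which would reverse the convexity inequality from y_0 to
    x_0, but there z_0 = x_0 forces y_0 = x_0 and that inequality is an
    equality. *)

(** * The Euclidean inner product *)

Section Dot.
Context {R : realType} {n : nat}.
Implicit Types u v w : 'rV[R]_n.

Lemma dotC u v : dot u v = dot v u.
Proof. by apply: eq_bigr => i _; rewrite mulrC. Qed.

Lemma dotDl u v w : dot (u + v) w = dot u w + dot v w.
Proof.
by rewrite /dot -big_split; apply: eq_bigr => i _; rewrite mxE mulrDl.
Qed.

Lemma dotZl c u w : dot (c *: u) w = c * dot u w.
Proof. by rewrite /dot mulr_sumr; apply: eq_bigr => i _; rewrite mxE mulrA. Qed.

Lemma dotNl u w : dot (- u) w = - dot u w.
Proof. by rewrite -scaleN1r dotZl mulN1r. Qed.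

Lemma dotDr u v w : dot w (u + v) = dot w u + dot w v.
Proof. by rewrite dotC dotDl !(dotC w). Qed.

Lemma dotZr c u w : dot w (c *: u) = c * dot w u.
Proof. by rewrite dotC dotZl dotC. Qed.

Lemma dotNr u w : dot w (- u) = - dot w u.
Proof. by rewrite dotC dotNl dotC. Qed.

Definition dotE := (dotDl, dotDr, dotNl, dotNr, dotZl, dotZr).

Lemma dot_ge0 u : 0 <= dot u u.
Proof. by apply: sumr_ge0 => i _; rewrite -expr2 sqr_ge0. Qed.

Lemma enorm_sqr u : enorm u ^+ 2 = dot u u.
Proof. by rewrite /enorm sqr_sqrtr ?dot_ge0. Qed.

Lemma enorm_ge0 u : 0 <= enorm u.
Proof. exact: sqrtr_ge0. Qed.

(** Expanding 0 <= |u - K v|^2 gives this instance of the Cauchy-Schwarz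
    inequality. *)
Lemma dot_le_of_enorm_le K u v : 0 < K ->
  enorm u <= K * enorm v -> dot u v <= K * dot v v.
Proof.
move=> K0 uv.
have uu : dot u u <= K ^+ 2 * dot v v.
  rewrite -!enorm_sqr -exprMn lerXn2r // nnegrE ?enorm_ge0 //.
  by rewrite mulr_ge0 ?enorm_ge0 // ltW.
have := dot_ge0 (u - K *: v); rewrite !dotE (dotC v u) => sq.
rewrite -(ler_pM2l K0); lra.
Qed.

End Dot.

(** * Decrease of the objective along a gradient step *)

Section Smoothness.
Context {R : realType} {n : nat}.
Implicit Types (mu L s : R) (f : 'rV[R]_n -> R) (u d h : 'rV[R]_n).

Lemma strongly_convex_subgradient mu f u v : 0 <= mu -> strongly_convex mu f ->
  f u + dot (grad f u) (v - u) <= f v.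
Proof.
move=> mu0 /(_ u v); rewrite enorm_sqr; apply: le_trans.
by rewrite lerDl mulr_ge0 ?dot_ge0 // divr_ge0.
Qed.

(** Along k equal steps h, convexity bounds the increase over each step by the
    slope at its right endpoint, and the Lipschitz bound compares the slope at
    u + i h with the slope at u with error L i |h|^2; the sum of the i up to k
    is k (k + 1) / 2. *)
Lemma smooth_steps mu L f u h k : 0 <= mu -> 0 < L ->
  strongly_convex mu f -> smooth L f ->
  f (u + k%:R *: h) <=
    f u + k%:R * dot (grad f u) h + L * (k%:R * (k%:R + 1) / 2) * dot h h.
Proof.
move=> mu0 L0 fconv fsm; elim: k => [|k IH].
  by rewrite scale0r addr0 !mul0r mulr0 mul0r !addr0.
set p := u + k.+1%:R *: h.
have back : f p - dot (grad f p) h <= f (u + k%:R *: h).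
  have := strongly_convex_subgradient mu f p (u + k%:R *: h) mu0 fconv.
  have -> : u + k%:R *: h - p = - h.
    by rewrite /p -natr1 scalerDl scale1r !opprD addrACA subrr add0r addrA
      subrr sub0r.
  by rewrite dotNr.
have lip : dot (grad f p - grad f u) h <= L * k.+1%:R * dot h h.
  apply: dot_le_of_enorm_le; first by rewrite mulr_gt0 ?ltr0Sn.
  apply: le_trans (fsm p u) _; rewrite /p addrAC subrr add0r.
  rewrite -mulrA; apply: ler_wpM2l; first exact: ltW.
  rewrite -(@ler_pXn2r _ 2 isT) ?nnegrE ?mulr_ge0 ?enorm_ge0 //.
  by rewrite exprMn !enorm_sqr !dotE mulrA expr2.
move: lip; rewrite !dotE -![k.+1%:R]natr1; move: back IH.
set G := dot (grad f p) h; set g := dot (grad f u) h; set H := dot h h.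
move: (k%:R : R) => K back IH lip.
lra.
Qed.

(** Cutting d into N equal steps turns the bound of [smooth_steps] into the
    claim with L / 2 replaced by L / 2 (1 + 1 / N), and N is arbitrary.
    Convexity thus replaces the usual integration of the gradient. *)
Lemma smooth_descent mu L f u d : 0 <= mu -> 0 < L ->
  strongly_convex mu f -> smooth L f ->
  f (u + d) <= f u + dot (grad f u) d + L / 2 * dot d d.
Proof.
move=> mu0 L0 fconv fsm; apply/ler_addgt0Pr => e e0.
set E := L / 2 * dot d d.
have E0 : 0 <= E by rewrite mulr_ge0 ?dot_ge0 ?divr_ge0 ?(ltW L0).
have [N] : exists N : nat, E / e < N%:R.
  exists (Num.bound (E / e)); apply: archi_boundP.
  by rewrite divr_ge0 ?(ltW e0).
move=> EN; have N0 : 0 < N%:R :> R.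
  by apply: le_lt_trans EN; rewrite divr_ge0 ?(ltW e0).
have Nn0 := lt0r_neq0 N0.
have := @smooth_steps mu L f u (N%:R^-1 *: d) N mu0 L0 fconv fsm.
rewrite scalerA divff // scale1r !dotE mulrA divff // mul1r.
have -> : L * (N%:R * (N%:R + 1) / 2) * (N%:R^-1 * (N%:R^-1 * dot d d))
   = E + E / N%:R by rewrite /E; field.
move/le_trans; apply; rewrite -!addrA !lerD2l.
by rewrite ler_pdivrMr // mulrC -ler_pdivrMr // ltW.
Qed.

Lemma gradient_step_decrease mu s f u : 0 <= mu -> 0 < s ->
  strongly_convex mu f -> smooth (1 / s) f ->
  f (u - s *: grad f u) <= f u - s / 2 * dot (grad f u) (grad f u).
Proof.
move=> mu0 s0 fconv fsm.
have := @smooth_descent mu (1 / s) f u (- (s *: grad f u)) mu0 _ fconv fsm.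
rewrite divr_gt0 // => /(_ isT) /le_trans; apply.
rewrite !dotE; move: (dot _ _) => G.
have -> : 1 / s / 2 * - (s * - (s * G)) = s / 2 * G.
  by field; rewrite lt0r_neq0.
lra.
Qed.

End Smoothness.

(** * The coefficients as hyperbolic functions *)

Section Hyperbolic.
Context {R : realType}.
Implicit Types x c t : R.

Lemma cosh_gt0 x : 0 < cosh x.
Proof. by rewrite divr_gt0 ?addr_gt0 ?expR_gt0. Qed.

Lemma cosh_sqr x : cosh x ^+ 2 = 1 + sinh x ^+ 2.
Proof.
rewrite /cosh /sinh; have := expRxMexpNx_1 x.
move: (expR x) (expR (- x)) => p q pq.
have -> : ((p + q) / 2) ^+ 2 = p * q + ((p - q) / 2) ^+ 2 by field.
by rewrite pq.
Qed.

Lemma sinhc_gt0 x : 0 < sinhc x.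
Proof.
rewrite /sinhc /sinh; have [x0|x0|_] := ltrgt0P x => //.
  by rewrite divr_gt0 // divr_gt0 // subr_gt0 ltr_expR; lra.
rewrite -mulrNN -invrN divr_gt0 ?oppr_gt0 //.
by rewrite pmulr_llt0 // subr_lt0 ltr_expR; lra.
Qed.

Lemma sinhcE x : sinhc x * x = sinh x.
Proof.
rewrite /sinhc; case: eqP => [->|/eqP x0]; last by rewrite divfK.
by rewrite /sinh oppr0 subrr mul0r mulr0.
Qed.

(** Equal to sinh (c t / 2) / c for c <> 0, and to its limit t / 2 for c = 0;
    this lets the convex and the strongly convex cases be treated together. *)
Definition sinh_scaled c t := t / 2 * sinhc (c / 2 * t).

Lemma sinh_scaled_gt0 c t : 0 < t -> 0 < sinh_scaled c t.
Proof. by move=> t0; rewrite mulr_gt0 ?sinhc_gt0 ?divr_gt0. Qed.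

Lemma sinh_scaled_sqr c t :
  sinh_scaled c t ^+ 2 = t ^+ 2 / 4 * sinhc (c / 2 * t) ^+ 2.
Proof. by rewrite /sinh_scaled; field. Qed.

Lemma cosh_sqr_scaled c t :
  cosh (c / 2 * t) ^+ 2 = 1 + c ^+ 2 * sinh_scaled c t ^+ 2.
Proof. by rewrite cosh_sqr -sinhcE /sinh_scaled; field. Qed.

Lemma cothc_scaled r c t : 0 < t ->
  2 * r / t * cothc (c / 2 * t) = r * cosh (c / 2 * t) / sinh_scaled c t.
Proof.
move=> t0; rewrite /cothc /tanhc /sinh_scaled; field.
by rewrite !lt0r_neq0 ?sinhc_gt0 ?cosh_gt0.
Qed.

Lemma tanhc_scaled r c t :
  r * t / 2 * tanhc (c / 2 * t) = r * sinh_scaled c t / cosh (c / 2 * t).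
Proof.
rewrite /tanhc /sinh_scaled; field.
by rewrite lt0r_neq0 ?cosh_gt0.
Qed.

Lemma cschc_scaled c t : 0 < t ->
  4 / t ^+ 2 * cschc (c / 2 * t) ^+ 2 = (sinh_scaled c t ^+ 2)^-1.
Proof.
move=> t0; rewrite /cschc /sinh_scaled; field.
by rewrite !lt0r_neq0 ?sinhc_gt0.
Qed.

End Hyperbolic.

(** * Algebra of the coupling and step coefficients *)

Section Coefficients.
Context {R : realType}.
Variables (mu s S C : R).
Hypotheses (s0 : 0 < s) (S0 : 0 < S) (C0 : 0 < C).
Hypothesis CS : C ^+ 2 = 1 + mu * S ^+ 2.
Let alpha := Num.sqrt s * C / S.

Lemma coupling_gt0 : 0 < alpha.
Proof. by rewrite /alpha divr_gt0 // mulr_gt0 // sqrtr_gt0. Qed.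

Lemma coupling_sqr : alpha ^+ 2 = mu * s + s / S ^+ 2.
Proof.
rewrite /alpha expr_div_n exprMn sqr_sqrtr ?(ltW s0) // CS.
by field; rewrite lt0r_neq0.
Qed.

(** The term s / S ^ 2 in [coupling_sqr] makes mu s strictly smaller than
    alpha ^ 2. *)
Lemma mul_lt1_of_coupling_le1 : alpha <= 1 -> mu * s < 1.
Proof.
move=> a1; apply: (@lt_le_trans _ _ (alpha ^+ 2)).
  by rewrite coupling_sqr ltrDl divr_gt0 // exprn_gt0.
by rewrite exprn_ile1 // ltW // coupling_gt0.
Qed.

(** When alpha <= 1, mu s <= alpha ^ 2 <= alpha by [coupling_sqr]. *)
Lemma mul_le_coupling : mu * s < 1 -> mu * s <= alpha.
Proof.
move=> mus1; have [a1|/ltW a1] := lerP alpha 1; last first.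
  exact: le_trans (ltW mus1) a1.
apply: (@le_trans _ _ (alpha ^+ 2)).
  by rewrite coupling_sqr lerDl divr_ge0 ?sqr_ge0 // ltW.
by rewrite expr2 ler_piMl // ltW // coupling_gt0.
Qed.

Lemma coupling_mul_step : alpha * (Num.sqrt s * S / C) = s.
Proof.
rewrite -[RHS](@sqr_sqrtr _ s) ?(ltW s0) // /alpha; field.
by rewrite !lt0r_neq0.
Qed.

Lemma coupling_balance :
  alpha * S ^+ 2 = Num.sqrt s * S / C * (1 + mu * S ^+ 2).
Proof. by rewrite -CS /alpha; field; rewrite !lt0r_neq0. Qed.

End Coefficients.

(** * Decrease of the energy *)

Section EnergyStep.
Context {R : realType} {n : nat}.

Definition energy (mu : R) (f : 'rV[R]_n -> R) xstar (A : R) x z : R :=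
  A * (f x - f xstar) + (1 + mu * A) / 2 * dot (z - xstar) (z - xstar).

(** At a minimizer the energy is monotone in its coefficient, even for negative
    coefficients: this covers a negative (1 - alpha) * a at the first step. *)
Lemma energy_le mu f xstar A A' x z : 0 <= mu -> minimizer f xstar ->
  A <= A' -> energy mu f xstar A x z <= energy mu f xstar A' x z.
Proof.
move=> mu0 fmin AA; rewrite /energy lerD //.
  by rewrite ler_wpM2r // subr_ge0 fmin.
rewrite ler_wpM2r ?dot_ge0 // ler_wpM2r ?invr_ge0 // lerD2l.
by rewrite ler_wpM2l.
Qed.

(** With w = z - x*, v = y - x* and p = x - y, the definition of y reads
    (1 - alpha) p = (alpha - mu s) (v - w), and the new z is a combination of w, v
    and the gradient g.  The difference of the two energies is then a times the
    slack of the gradient step, plus (1 - alpha) a and alpha a times the slacks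
    of strong convexity at x and at x*, plus nonnegative multiples of
    (1 - alpha) |p|^2 and (alpha - mu s) |w - v|^2. *)
Lemma energy_step (mu s alpha delta a : R) f xstar x y z : 0 <= mu -> 0 < s ->
  strongly_convex mu f -> smooth (1 / s) f ->
  0 <= a -> mu * s <= alpha -> mu * s < 1 ->
  alpha * delta = s -> alpha * a = delta * (1 + mu * a) ->
  alpha <= 1 \/ z = x ->
  y = x + ((alpha - mu * s) / (1 - mu * s)) *: (z - x) ->
  energy mu f xstar a (y - s *: grad f y)
    (z + delta *: (mu *: y - mu *: z - grad f y))
  <= energy mu f xstar ((1 - alpha) * a) x z.
Proof.
move=> mu0 s0 fconv fsm a0 mus_le mus_lt ad_s aa_dB xz yE.
have coupling : (1 - alpha) *: (x - y) = (alpha - mu * s) *: (y - z).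
  apply/rowP => i; rewrite yE !mxE; field; rewrite gt_eqF // subr_gt0 //.
set g := grad f y; pose w := z - xstar; pose v := y - xstar; pose p := x - y.
have descent : f (y - s *: g) <= f y - s / 2 * dot g g.
  exact: gradient_step_decrease fconv fsm.
have at_min : f y - dot g v + mu / 2 * dot v v <= f xstar.
  have := fconv y xstar; rewrite enorm_sqr.
  by rewrite -[xstar - y]opprB -/v dotNr dotNl dotNr opprK.
have at_x : (1 - alpha) * (f y + dot g p + mu / 2 * dot p p)
    <= (1 - alpha) * f x /\ 0 <= (1 - alpha) * dot p p.
  (* When z = x, also y = x: then p = 0 and the first inequality is an equality,
     whatever the sign of 1 - alpha. *)
  case: xz => [alpha1|zx].
    split; last by rewrite mulr_ge0 ?dot_ge0 ?subr_ge0.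
    by rewrite ler_wpM2l ?subr_ge0 //; have := fconv y x; rewrite enorm_sqr.
  have yx : y = x by rewrite yE zx subrr scaler0 addr0.
  have -> : p = 0 *: p by rewrite /p yx subrr scaler0.
  by rewrite yx !(dotZl, dotZr) !(mul0r, mulr0) !addr0.
case: at_x => at_x p_ge0.
have z'E : z + delta *: (mu *: y - mu *: z - g) - xstar
    = (1 - mu * delta) *: w + (mu * delta) *: v - delta *: g.
  by apply/rowP => i; rewrite /w /v !mxE; ring.
have gp : (1 - alpha) * dot g p = (alpha - mu * s) * (dot g v - dot g w).
  have -> : dot g v - dot g w = dot g (y - z).
    rewrite /v /w !dotE; ring.
  by rewrite -!dotZr -coupling.
rewrite /energy z'E -/w -/g; clearbody w v p g.
have alpha_a_ge0 : 0 <= alpha * a.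
  apply: mulr_ge0 a0; apply: le_trans mus_le.
  by rewrite mulr_ge0 // ltW.
set u := _ - delta *: g.
(* alpha delta = s and alpha a = delta (1 + mu a) remove delta: every
   coefficient below becomes a combination of a, alpha, mu and s. *)
have newz : (1 + mu * a) * dot u u
    = (1 + mu * a - mu * (alpha * a)) * dot w w + mu * (alpha * a) * dot v v
      - a * (alpha - mu * s) * (mu * dot (w - v) (w - v) + 2 * dot g w)
      - 2 * mu * (a * s) * dot g v + a * s * dot g g.
  have -> : a * s = alpha * a * delta by rewrite -ad_s; ring.
  have -> : a * (alpha - mu * s) = alpha * a * (1 - mu * delta).
    by rewrite -ad_s; ring.
  by rewrite aa_dB /u !dotE (dotC w g) (dotC v g) (dotC v w); ring.
have := ler_wpM2l a0 descent.
have := ler_wpM2l a0 at_x.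
have := ler_wpM2l alpha_a_ge0 at_min.
have := congr1 ( *%R a) gp.
have : 0 <= mu * a * ((1 - alpha) * dot p p).
  by apply: mulr_ge0 p_ge0; rewrite mulr_ge0.
have : 0 <= mu * a * (alpha - mu * s) * dot (w - v) (w - v).
  by apply: mulr_ge0 (dot_ge0 _); rewrite mulr_ge0 ?mulr_ge0 ?subr_ge0.
move: newz; clear.
lra.
Qed.

End EnergyStep.

(** * Convergence rate *)

Theorem corollary11 (R : realType) (n : nat) (mu s : R) (hmu : 0 <= mu)
  (hs : 0 < s) (f : 'rV[R]_n -> R)
  (hC1 : continuously_differentiable f)
  (hconv : strongly_convex mu f)
  (hsmooth : smooth (1 / s) f)
  (xstar : 'rV[R]_n) (hxstar : minimizer f xstar)
  (t : nat -> R)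
  (ht_ge0 : forall k : nat, 0 <= t k)
  (ht_incr : forall i j : nat, (i < j)%N -> t i < t j)
  (ht_le1 : forall k : nat, (2 <= k)%N ->
    2 * Num.sqrt s / t k * cothc (Num.sqrt mu / 2 * t k) <= 1)
  (ht_step : forall k : nat,
    (1 - 2 * Num.sqrt s / t k.+1 * cothc (Num.sqrt mu / 2 * t k.+1))
      * (t k.+1 ^+ 2 / 4) * sinhc (Num.sqrt mu / 2 * t k.+1) ^+ 2
    <= t k ^+ 2 / 4 * sinhc (Num.sqrt mu / 2 * t k) ^+ 2)
  (x y z : nat -> 'rV[R]_n)
  (hxz0 : x 0%N = z 0%N)
  (hy : forall k : nat,
    y k = x k
      + ((2 * Num.sqrt s / t k.+1 * cothc (Num.sqrt mu / 2 * t k.+1) - mu * s)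
           / (1 - mu * s)) *: (z k - x k))
  (hx : forall k : nat, x k.+1 = y k - s *: grad f (y k))
  (hz : forall k : nat,
    z k.+1 = z k
      + (Num.sqrt s * t k.+1 / 2 * tanhc (Num.sqrt mu / 2 * t k.+1))
          *: (mu *: y k - mu *: z k - grad f (y k))) :
  forall k : nat, 0 < t k ->
    f (x k) - f xstar
    <= 4 / t k ^+ 2 * cschc (Num.sqrt mu / 2 * t k) ^+ 2
       * (1 / 2 * cosh (Num.sqrt mu / 2 * t 0%N) ^+ 2
            * enorm (x 0%N - xstar) ^+ 2
          + t 0%N ^+ 2 / 4 * sinhc (Num.sqrt mu / 2 * t 0%N) ^+ 2
            * (f (x 0%N) - f xstar)).
Proof.
pose c := Num.sqrt mu.
pose S k := sinh_scaled c (t k).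
pose A k := S k ^+ 2.
pose C k := cosh (c / 2 * t k).
pose alpha k := Num.sqrt s * C k / S k.
have t_gt0 k : 0 < t k.+1 by apply: le_lt_trans (ht_ge0 0%N) (ht_incr _ _ _).
have S_gt0 k : 0 < S k.+1 by apply: sinh_scaled_gt0.
have C_gt0 k : 0 < C k by apply: cosh_gt0.
have C_sqr k : C k ^+ 2 = 1 + mu * A k.
  by rewrite /C cosh_sqr_scaled sqr_sqrtr.
have alphaE k : 2 * Num.sqrt s / t k.+1 * cothc (c / 2 * t k.+1) = alpha k.+1.
  exact: cothc_scaled.
have alpha_le1 k : alpha k.+2 <= 1 by rewrite -alphaE ht_le1.
have mus_lt1 : mu * s < 1.
  exact: mul_lt1_of_coupling_le1 _ _ _ _ hs (S_gt0 1%N) (C_gt0 2) (C_sqr 2)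
    (alpha_le1 0%N).
have A_step k : (1 - alpha k.+1) * A k.+1 <= A k.
  by rewrite /A !sinh_scaled_sqr -alphaE mulrA ht_step.
pose E k := energy mu f xstar (A k) (x k) (z k).
have E_dec k : E k.+1 <= E k.
  apply: le_trans (energy_le _ _ _ _ _ (x k) (z k) hmu hxstar (A_step k)).
  rewrite /E hx hz tanhc_scaled.
  apply: energy_step => //.
  - exact: sqr_ge0.
  - exact: mul_le_coupling _ _ _ _ hs (S_gt0 k) (C_gt0 _) (C_sqr _) mus_lt1.
  - exact: coupling_mul_step.
  - exact: coupling_balance.
  - by case: k => [|k]; [right | left].
  - by rewrite -alphaE.
have E_le k : E k <= E 0%N by elim: k => // k; apply: le_trans.
move=> k tk.
have Ak : 0 < A k by rewrite exprn_gt0 // sinh_scaled_gt0.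
rewrite cschc_scaled // mulrC ler_pdivlMr //.
have -> : 1 / 2 * cosh (c / 2 * t 0%N) ^+ 2 * enorm (x 0%N - xstar) ^+ 2
    + t 0%N ^+ 2 / 4 * sinhc (c / 2 * t 0%N) ^+ 2 * (f (x 0%N) - f xstar) = E 0%N.
  rewrite -sinh_scaled_sqr enorm_sqr /E /energy -hxz0 addrC; congr (_ + _).
  by rewrite -C_sqr /C; field.
apply: le_trans (E_le k).
by rewrite /E /energy mulrC lerDl mulr_ge0 ?dot_ge0 // -C_sqr divr_ge0 ?sqr_ge0.
Qed.
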